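(* Let $\mathcal{I}_z=\{z(\psi):\psi\in\mathcal{D}\}\subseteq\mathbb{R}^m$ be the image of the map $z$. Then its closure is $$\operatorname{cl}(\mathcal{I}_z)=\bigcup_{T\in[m,n+1]}\operatorname{conv}\Big(\Big\{z_{(\tau)} : \tau\in\binom{T}{n}\Big\}\Big).$$
   Context: Let $1\le n<m$ be integers and let $\lambda_1>\lambda_2>\cdots>\lambda_m>0$ be real numbers; $\Lambda=\operatorname{diag}(\lambda)$. $\mathbf 1$ is the all-ones vector (of the appropriate length). $V$ is the $m\times n$ Vandermonde matrix with $V_{i,k}=\lambda_i^{k-1}$. $\mathcal{D}$ is the set of $\psi\in\mathbb{R}^m$ with non-negative entries, at least $n$ of which are non-zero. For $\psi\in\mathcal{D}$, with $\Psi=\operatorname{diag}(\psi)$, the matrix $V^T\Psi\Lambda V$ is non-singular and $z(\psi)=\mathbf 1-\Lambda V(V^T\Psi\Lambda V)^{-1}V^T\psi\in\mathbb{R}^m$ (this is $\mathbf 1-\omega$, where $\omega$ is the PLS shrinkage vector). $[m]=\{1,\dots,m\}$; $\binom{S}{k}$ is the set of $k$-element subsets of $S$; $[m,k]=\binom{[m]}{k}$. For $\tau\in[m,n]$, $S_\tau$ is the $m\times n$ selection matrix such that $S_\tau^Tx$ is the subvector of $x$ with entries indexed by $\tau$, and $z_{(\tau)}=z(S_\tau\mathbf 1)$; equivalently $z_{(\tau)}=\mathbf 1-\Lambda V(S_\tau^T\Lambda V)^{-1}\mathbf 1$, with entries $z_{(\tau),i}=\prod_{j\in\tau}(1-\lambda_i/\lambda_j)$.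 $\operatorname{conv}$ denotes convex hull. *)

(* Defs.v *)
From mathcomp Require Import all_boot all_order all_algebra.
From mathcomp Require Import boolp classical_sets reals topology normedtype convex.
Set Implicit Arguments.
Unset Strict Implicit.
Unset Printing Implicit Defensive.
Import Order.TTheory GRing.Theory Num.Theory.
Import numFieldNormedType.Exports.
Local Open Scope classical_set_scope.
Local Open Scope ring_scope.

Definition diagc (R : realType) (m : nat) (x : 'cV[R]_m) : 'M[R]_m :=
  diag_mx x^T.

(* Entry (i, k) is [lambda i 0 ^+ k]; [k : 'I_n] starts at 0, so this is
   lambda_i^(k-1) when columns are numbered from 1. *)
Definition Vmx (R : realType) (m n : nat) (lambda : 'cV[R]_m) : 'M[R]_(m, n) :=
  (Vandermonde n lambda^T)^T.

Definition Dset (R : realType) (m n : nat) : set 'cV[R]_m :=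
  [set psi : 'cV[R]_m | (forall i, 0 <= psi i 0) /\
             (n <= #|[set i : 'I_m | (psi i 0 != 0)%R]%SET|)%N].
Arguments Dset R m n : clear implicits.

(* [invmx M] is [M] itself when [M] is singular; for [psi] in [Dset R m n] and
   distinct positive [lambda i 0] the matrix inverted here is non-singular. *)
Definition zvec (R : realType) (m n : nat) (lambda psi : 'cV[R]_m) : 'cV[R]_m :=
  let V := Vmx n lambda in
  let Lambda := diagc lambda in
  let Psi := diagc psi in
  const_mx 1 - Lambda *m V *m invmx (V^T *m Psi *m Lambda *m V) *m V^T *m psi.

(* Columns are indexed by the elements of [tau] in increasing order. *)
Definition selmx (R : realType) (m : nat) (tau : {set 'I_m}) :
    'M[R]_(m, #|tau|) :=
  \matrix_(i, k) (i == enum_val k)%:R.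

Definition ztau (R : realType) (m n : nat) (lambda : 'cV[R]_m)
    (tau : {set 'I_m}) : 'cV[R]_m :=
  zvec n lambda (selmx R tau *m const_mx 1).

Definition ksubsets (m : nat) (S : {set 'I_m}) (k : nat) : set {set 'I_m} :=
  [set tau | tau \subset S /\ #|tau| = k].

Definition conv_hull (R : realType) (E : lmodType R) (A : set E) : set E :=
  smallest (@convex_set R E) A.

(* Main.v *)
Require Import Defs.
From mathcomp Require Import all_boot all_order all_algebra.
From mathcomp Require Import boolp classical_sets reals topology normedtype convex.
From mathcomp Require Import interval_inference.
Import Order.TTheory GRing.Theory Num.Theory.
Import numFieldNormedType.Exports.
Local Open Scope ring_scope.

(** The vector [z(psi)] consists of the values at the [lambda_i] of the
    polynomial [p] of degree at most [n] with [p(0) = 1] that is orthogonal,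
    for the weights [psi], to all polynomials of degree less than [n]; for
    [psi] the indicator of [tau] this is [prod_(j in tau) (1 - X / lambda_j)].
    For [|T| = n + 1], Lagrange interpolation writes [p] as
    [sum_(t in T) c_t prod_(j in T, j <> t) (1 - X / lambda_j)], and evaluation
    at [0] gives [sum c_t = 1]. So the hull attached to [T] is the set of [p]
    with all [c_t >= 0], which is closed.
    If all [c_t > 0], weights on [T] making [p] orthogonal are written down
    explicitly, so every hull is in the closure of the image. Conversely, a
    Caratheodory reduction shrinks the support of [psi] to [n + 1] points [T]
    while preserving orthogonality of the same [p], and testing against
    polynomials vanishing on [T] minus two points shows that the [c_t] have
    equal signs. *)

(** * Nodal polynomials and Lagrange interpolation *)

Section Nodes.
Set Implicit Arguments.
Unset Strict Implicit.
Variables (R : realFieldType) (I : finType) (x : I -> R).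
Hypothesis x_inj : injective x.
Hypothesis x_gt0 : forall i, 0 < x i.
Implicit Types (A T : {set I}) (p q r s : {poly R}) (w c : I -> R).

Lemma node_neq0 i : x i != 0. Proof. by rewrite gt_eqF. Qed.

(** Factors are scaled to equal 1 at 0, so a linear combination of such products takes its
    coefficient sum as value at 0. *)
Definition nodal A : {poly R} := \prod_(j in A) (1 - (x j)^-1 *: 'X).

Lemma horner_nodal A y : (nodal A).[y] = \prod_(j in A) (1 - (x j)^-1 * y).
Proof. by rewrite horner_prod; apply: eq_bigr => j _; rewrite !hornerE. Qed.

Lemma nodal_at0 A : (nodal A).[0] = 1.
Proof. by rewrite horner_nodal big1 // => j _; rewrite mulr0 subr0. Qed.

Lemma size_nodal A : (size (nodal A) <= #|A|.+1)%N.
Proof.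
rewrite /nodal (leq_trans (size_poly_prod_leq _ _)) //.
rewrite leq_subLR addnS ltnS -sum1_card -big_split /=.
apply: leq_sum => j _.
rewrite (leq_trans (size_polyD _ _)) // size_poly1 size_polyN geq_max /=.
by rewrite (leq_trans (size_scale_leq _ _)) // size_polyX.
Qed.

Lemma nodal_eq0 A i : ((nodal A).[x i] == 0) = (i \in A).
Proof.
rewrite horner_nodal; apply/idP/idP => [|iA].
  rewrite prodf_seq_eq0 => /hasP[j _ /andP[jA]].
  rewrite subr_eq0 eq_sym mulrC (can2_eq (mulfVK _) (mulfK _)) ?node_neq0 //.
  by rewrite mul1r => /eqP /x_inj ->.
by rewrite (bigD1 i) //= mulVf ?node_neq0 // subrr mul0r.
Qed.

Lemma nodalD1_neq0 A i : (nodal (A :\ i)).[x i] != 0.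
Proof. by rewrite nodal_eq0 !inE eqxx. Qed.

Lemma horner_nodal_sum T c t : t \in T ->
  (\sum_(j in T) c j *: nodal (T :\ j)).[x t] = c t * (nodal (T :\ t)).[x t].
Proof.
move=> tT; rewrite horner_sum (bigD1 t) //= hornerZ big1 ?addr0 // => j.
case/andP=> jA jt; rewrite hornerZ; apply/eqP.
by rewrite mulf_eq0 nodal_eq0 !inE [t == j]eq_sym jt tT orbT.
Qed.

Lemma poly_eq0_on A p : (size p <= #|A|)%N ->
  (forall i, i \in A -> p.[x i] = 0) -> p = 0.
Proof.
move=> sp pA; apply: (@roots_geq_poly_eq0 _ _ [seq x i | i in A]).
- by apply/allP => y /fintype.imageP[i iA ->]; apply/eqP/pA.
- by rewrite map_inj_uniq ?enum_uniq.
- by rewrite size_image.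
Qed.

Lemma lagrange_nodal A p : (size p <= #|A|)%N ->
  p = \sum_(t in A) (p.[x t] / (nodal (A :\ t)).[x t]) *: nodal (A :\ t).
Proof.
move=> sp; apply/eqP; rewrite -subr_eq0; apply/eqP.
apply: (@poly_eq0_on A).
  rewrite (leq_trans (size_polyD _ _)) // geq_max sp size_polyN /=.
  apply: (leq_trans (size_sum _ _ _)); apply/bigmax_leqP => t tA.
  rewrite (leq_trans (size_scale_leq _ _)) // (leq_trans (size_nodal _)) //.
  by rewrite [#|A|](cardsD1 t) tA.
move=> i iA; rewrite hornerD hornerN horner_nodal_sum //.
by rewrite divfK ?nodalD1_neq0 // subrr.
Qed.

Lemma sum_lagrange_coef A p : (size p <= #|A|)%N ->
  \sum_(t in A) p.[x t] / (nodal (A :\ t)).[x t] = p.[0].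
Proof.
move=> sp; rewrite {2}(lagrange_nodal sp) horner_sum.
by apply: eq_bigr => t _; rewrite hornerZ nodal_at0 mulr1.
Qed.

(** * Weighted orthogonality: uniqueness, signs and support *)

Definition supp w : {set I} := [set i | w i != 0].

Definition orth (n : nat) w p :=
  forall r, (size r <= n)%N -> \sum_i w i * p.[x i] * r.[x i] = 0.

(** All terms are nonnegative, so [s] has at least [n] roots, too many for its degree. This gives
    both uniqueness of the orthogonal polynomial and nonsingularity of the Gram matrix. *)
Lemma weighted_sq_eq0 n w s : (forall i, 0 <= w i) -> (n <= #|supp w|)%N ->
  (size s <= n)%N -> \sum_i w i * x i * s.[x i] ^+ 2 = 0 -> s = 0.
Proof.
move=> w0 nw sn s0; apply: (@poly_eq0_on (supp w)); first exact: leq_trans nw.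
move=> i; rewrite inE => wi; apply/eqP; rewrite -sqrf_eq0.
have pos j : true -> 0 <= w j * x j * s.[x j] ^+ 2.
  by move=> _; rewrite mulr_ge0 ?sqr_ge0 // mulr_ge0 ?(ltW (x_gt0 j)).
move: s0 => /(psumr_eq0P pos) /(_ i isT) /eqP.
by rewrite !mulf_eq0 (negPf wi) (gt_eqF (x_gt0 i)).
Qed.

(** [p - q] vanishes at 0, so it is [s * 'X] with [s] of degree below [n]; testing both polynomials
    against [s] and subtracting leaves a weighted sum of squares of [s]. *)
Lemma orth_unique n w p q : (forall i, 0 <= w i) -> (n <= #|supp w|)%N ->
  (size p <= n.+1)%N -> (size q <= n.+1)%N -> p.[0] = 1 -> q.[0] = 1 ->
  orth n w p -> orth n w q -> p = q.
Proof.
move=> w0 nw sp sq p1 q1 op oq.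
have /factor_theorem[s] : root (p - q) 0.
  by rewrite /root hornerD hornerN p1 q1 subrr.
rewrite subr0 => pq.
have ss : (size s <= n)%N.
  have [->|s0] := eqVneq s 0; first by rewrite size_poly0.
  rewrite -ltnS -(size_mulX s0) -pq (leq_trans (size_polyD _ _)) //.
  by rewrite geq_max sp size_polyN.
have s0 : s = 0.
  apply: (weighted_sq_eq0 w0 nw ss).
  transitivity
    (\sum_i w i * p.[x i] * s.[x i] - \sum_i w i * q.[x i] * s.[x i]).
    rewrite -sumrB; apply: eq_bigr => i _.
    have -> : p.[x i] = s.[x i] * x i + q.[x i].
      have := congr1 (horner^~ (x i)) pq.
      rewrite hornerM hornerX hornerD hornerN => /eqP.
      by rewrite subr_eq => /eqP.
    rewrite -mulrBl -mulrBr addrK expr2 !mulrA; congr (_ * _).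
    by rewrite -!mulrA [x i * _]mulrC.
  by rewrite op // oq // subrr.
by apply/eqP; rewrite -subr_eq0 pq s0 mul0r.
Qed.

(* With these weights, orthogonality to [r] is the Lagrange formula for the
   value of [r * 'X] at [0]. *)
Lemma orth_combination n T c : #|T| = n.+1 -> (forall t, t \in T -> 0 < c t) ->
  orth n (fun t => if t \in T then
            x t / (c t * (nodal (T :\ t)).[x t] ^+ 2) else 0)
    (\sum_(t in T) c t *: nodal (T :\ t)).
Proof.
move=> cT c0 r sr.
rewrite (bigID (mem T)) /= [X in _ + X]big1 => [|i iT]; last first.
  by rewrite (negPf iT) !mul0r.
have sXr : (size (r * 'X)%R <= #|T|)%N.
  have [->|r0] := eqVneq r 0; first by rewrite mul0r size_poly0.
  by rewrite size_mulX // cT ltnS.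
transitivity ((r * 'X).[0])%R; last by rewrite hornerM hornerX mulr0.
rewrite addr0 -(sum_lagrange_coef sXr); apply: eq_bigr => t tT.
rewrite tT horner_nodal_sum // hornerM hornerX.
have := nodalD1_neq0 T t; have := c0 t tT.
set a := (nodal _).[_]; move: (c t) => ct ct0 a0.
have d0 : ct * a != 0 by rewrite mulf_neq0 // gt_eqF.
rewrite expr2 [ct * (a * a)]mulrA; set d := ct * a in d0 *.
by rewrite [d * a]mulrC invfM [x t * _]mulrA divfK // [LHS]mulrC mulrA.
Qed.

(* Testing against [nodal (T :\ s :\ t)] leaves only the terms [s] and [t];
   writing [p.[x t] = c t * (nodal (T :\ t)).[x t]], their vanishing sum reads
   [K * c s - K' * c t = 0] with [K, K' > 0]. *)
Lemma orth_same_sign n T w p : #|T| = n.+1 ->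
  (forall t, t \in T -> 0 < w t) -> supp w \subset T -> orth n w p ->
  {in T &, forall s t : I, 0 < p.[x s] / (nodal (T :\ s)).[x s] ->
     0 < p.[x t] / (nodal (T :\ t)).[x t]}.
Proof.
move=> cT w0 wT op s t sT tT; have [->//|st] := eqVneq s t.
set r := nodal (T :\ s :\ t).
have sr : (size r <= n)%N.
  rewrite (leq_trans (size_nodal _)) //.
  by move: cT; rewrite (cardsD1 s) sT (cardsD1 t) !inE tT eq_sym st => -[<-].
have as_ : (nodal (T :\ s)).[x s] = (1 - (x t)^-1 * x s) * r.[x s].
  by rewrite !horner_nodal (big_setD1 t) // !inE eq_sym st.
have at_ : (nodal (T :\ t)).[x t] = (1 - (x s)^-1 * x t) * r.[x t].
  rewrite !horner_nodal (big_setD1 s) ?inE ?st //=; congr (_ * _).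
  by apply: eq_bigl => i; rewrite !inE andbCA.
have := nodalD1_neq0 T s; have := nodalD1_neq0 T t.
have ts : t != s by rewrite eq_sym.
have := op r sr; rewrite (bigD1 s) //= (bigD1 t) //= big1.
  rewrite addr0 as_ at_.
  set rs := r.[x s]; set rt := r.[x t]; set ps := p.[x s]; set pt := p.[x t].
  rewrite !mulf_eq0 !negb_or => op0 /andP[dt0 rt0] /andP[ds0 rs0].
  set ds := 1 - (x t)^-1 * x s in ds0 *.
  set dt := 1 - (x s)^-1 * x t in dt0 *.
  (* The factors [dt] and [ds] have opposite signs, [dt = - (k * ds)], which turns the vanishing sum
     into a difference. *)
  set k := x t / x s.
  have dtE : dt = - (k * ds).
    have kK : k * ((x t)^-1 * x s) = 1.
      by rewrite mulrACA mulfV ?mulVf ?node_neq0 // mulr1.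
    by rewrite /ds mulrBr mulr1 kK opprB /dt /k mulrC.
  set cs := ps / _; set ct := pt / _ => cs0.
  have k0 : 0 < k by rewrite divr_gt0.
  have psE : ps = cs * (ds * rs) by rewrite divfK // mulf_neq0.
  have ptE : pt = ct * (dt * rt) by rewrite divfK // mulf_neq0.
  clearbody cs ct k.
  move: op0; rewrite psE ptE dtE !(mulrN, mulNr) !mulrA => /eqP.
  rewrite subr_eq0 ![_ * ds * _]mulrAC.
  move=> /eqP/(mulIf ds0) eqc.
  have sq0 (y : R) : y != 0 -> 0 < y ^+ 2 by move=> y0; rewrite exprn_even_gt0.
  have : 0 < w s * cs * rs * rs.
    by rewrite -mulrA -expr2 mulr_gt0 ?sq0 // mulr_gt0 ?w0.
  by rewrite eqc -mulrA -expr2 pmulr_lgt0 ?sq0 // pmulr_lgt0 // pmulr_rgt0 ?w0.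
move=> i /andP[is_ it]; apply/eqP; rewrite !mulf_eq0.
have [//|wi] := eqVneq (w i) 0.
by rewrite nodal_eq0 !inE is_ it (fintype.subsetP wT) ?orbT // inE.
Qed.

(** Otherwise the nodal polynomial of the support without [i] has degree below [n], and testing
    against it leaves one nonzero term, at [i]. *)
Lemma orth_support_gt n w p : (exists i, w i != 0) ->
  (forall i, w i != 0 -> p.[x i] != 0) -> orth n w p -> (n < #|supp w|)%N.
Proof.
move=> [i wi] pw op; rewrite ltnNge; apply/negP => wn.
have /op : (size (nodal (supp w :\ i)) <= n)%N.
  rewrite (leq_trans (size_nodal _)) // (leq_trans _ wn) //.
  by rewrite [X in (_ <= X)%N](cardsD1 i) inE wi.
rewrite (bigD1 i) //= big1 => [|j ji].
  by apply/eqP; rewrite addr0 !mulf_neq0 ?nodalD1_neq0 ?pw.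
apply/eqP; rewrite !mulf_eq0; have [//|wj] := eqVneq (w j) 0.
by rewrite nodal_eq0 !inE ji wj orbT.
Qed.

(* Caratheodory: a nonzero nonnegative solution of a linear system of rank at
   most [n], one more equation keeping the total mass, can be moved along a
   kernel vector until a coordinate vanishes. *)
Lemma orth_reduce n w p : (forall i, 0 <= w i) -> (n.+1 < #|supp w|)%N ->
  orth n w p ->
  exists w', [/\ forall i, 0 <= w' i, supp w' \proper supp w,
     exists i, w' i != 0 & orth n w' p].
Proof.
move=> w0 nw op; set S := supp w in nw *.
(* Column [j < n] encodes orthogonality to ['X^j], the last column the total mass. *)
pose B : 'M[R]_(#|S|, n.+1) := \matrix_(k, j)
  (if (j < n)%N then p.[x (enum_val k)] * x (enum_val k) ^+ j else 1).
have [u u0 uB] : exists2 u : 'rV_#|S|, u != 0 & u *m B = 0.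
  have : ~~ row_free B.
    by rewrite -row_leq_rank -ltnNge (leq_ltn_trans (rank_leq_col _)).
  rewrite -kermx_eq0 => /rowV0Pn[u /sub_kermxP uB u0].
  by exists u.
(* [u] extended by zero outside [S]. *)
pose f i := \sum_(k | enum_val k == i) u 0 k.
have sumf (g : I -> R) : \sum_i f i * g i = \sum_k u 0 k * g (enum_val k).
  rewrite (partition_big (@enum_val _ S) predT) //=.
  apply: eq_bigr => i _; rewrite mulr_suml.
  by apply: eq_bigr => k /eqP ->.
have f_enum k : f (enum_val k) = u 0 k.
  rewrite /f (bigD1 k) //= big1 ?addr0 // => l /andP[/eqP /enum_val_inj -> ].
  by rewrite eqxx.
have fS i : f i != 0 -> i \in S.
  apply: contraR => iS; rewrite /f big1 // => k /eqP ki.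
  by rewrite -ki enum_valP in iS.
have uBj (j : 'I_n.+1) : \sum_k u 0 k * B k j = 0.
  by move/matrixP: uB => /(_ 0 j); rewrite !mxE.
have f_sum : \sum_i f i = 0.
  under eq_bigr => i _ do rewrite -[f i]mulr1.
  rewrite (sumf (fun=> 1)) -[RHS](uBj ord_max).
  by apply: eq_bigr => k _; rewrite mxE ltnn.
have f_orth : orth n f p.
  move=> r sr; under eq_bigr => i _ do rewrite -mulrA.
  rewrite (sumf (fun i => p.[x i] * r.[x i])).
  under eq_bigr => k _ do rewrite (horner_coef_wide _ sr) !mulr_sumr.
  rewrite exchange_big big1 //= => j _.
  transitivity (r`_j * \sum_k u 0 k * B k (widen_ord (leqnSn n) j))%R;
    last by rewrite uBj mulr0.
  rewrite mulr_sumr; apply: eq_bigr => k _.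
  by rewrite mxE /= ltn_ord [p.[_] * _]mulrCA [LHS]mulrCA.
have [i1 fi1] : exists i, 0 < f i.
  apply/existsP; apply: contraR u0 => /existsPn fle; apply/eqP/rowP => k.
  rewrite mxE -f_enum; apply/eqP; rewrite -oppr_eq0; apply/eqP.
  move: (enum_val k) isT; apply: psumr_eq0P => [i _|].
    by rewrite oppr_ge0 leNgt fle.
  by rewrite sumrN f_sum oppr0.
have [i0 fi0 wmin] : exists2 i0, 0 < f i0 &
    forall i, 0 < f i -> w i0 / f i0 <= w i / f i.
  case: (@arg_minP _ _ _ i1 (fun i => 0 < f i) (fun i => w i / f i) fi1).
  by move=> i0 ? h; exists i0.
(* The minimal ratio is the largest step that keeps the weights nonnegative; the weight at [i0]
   becomes 0. *)
set a := w i0 / f i0 in wmin.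
have a0 : 0 <= a by rewrite divr_ge0 // ltW.
exists (fun i => w i - a * f i); split.
- move=> i; rewrite subr_ge0; have [fi|fi] := ltrP 0 (f i).
    by rewrite -ler_pdivlMr // wmin.
  by rewrite (le_trans _ (w0 i)) // mulr_ge0_le0.
- apply/properP; split.
    apply/fintype.subsetP => i; rewrite !inE; apply: contraNN => /eqP wi.
    have [->|/fS] := eqVneq (f i) 0; first by rewrite wi mulr0 subr0.
    by rewrite inE wi eqxx.
  exists i0; first by apply: fS; rewrite gt_eqF.
  by rewrite inE negbK divfK ?subrr // gt_eqF.
(* The step preserves the total mass because [f] sums to 0, so if all new weights vanished, [w]
   would vanish too. *)
- apply/existsP; apply: contraTT nw => /existsPn w'0.
  have : \sum_i w i = 0.
    transitivity (\sum_i w i - a * \sum_i f i)%R.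
      by rewrite f_sum mulr0 subr0.
    rewrite mulr_sumr -sumrB.
    by apply: big1 => i _; apply/eqP; rewrite -[_ == _]negbK w'0.
  move/(psumr_eq0P (fun i _ => w0 i)) => wz.
  suff -> : S = finset.set0 by rewrite cards0.
  by apply/setP => i; rewrite !inE wz ?eqxx.
move=> r sr; transitivity
    (\sum_i w i * p.[x i] * r.[x i] - a * \sum_i f i * p.[x i] * r.[x i])%R.
  by rewrite mulr_sumr -sumrB; apply: eq_bigr => i _; rewrite !mulrBl !mulrA.
by rewrite op // f_orth // mulr0 subrr.
Qed.

(** Strong induction on the support size, which exceeds [n] by [orth_support_gt]. With exactly
    [n.+1] nodes the coefficients share a sign, positive since they sum to 1; otherwise
    [orth_reduce] applies. Nonnegative coefficients mean that [p] weakly alternates in sign along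
    the ordered nodes of [T]. *)
Lemma orth_alternating_nonroot n w p : (forall i, 0 <= w i) ->
  (exists i, w i != 0) -> (forall i, w i != 0 -> p.[x i] != 0) ->
  (size p <= n.+1)%N -> p.[0] = 1 -> orth n w p ->
  exists2 T : {set I}, #|T| = n.+1 &
    forall t, t \in T -> 0 <= p.[x t] / (nodal (T :\ t)).[x t].
Proof.
move=> w0 wex wp sp p1 op; have [k] := ubnP #|supp w|.
elim: k w w0 wex wp op => // k IH w w0 wex wp op; rewrite ltnS => wk.
have := orth_support_gt wex wp op; rewrite leq_eqVlt => /orP[/eqP cT|wbig].
  exists (supp w) => // t tT; apply: ltW.
  have [s sT cs] : exists2 s : I, s \in supp w &
      0 < p.[x s] / (nodal (supp w :\ s)).[x s].
    apply/exists_inP; apply: contraT => /exists_inPn cle.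
    have: \sum_(t in supp w) p.[x t] / (nodal (supp w :\ t)).[x t] <= 0.
      by apply: sumr_le0 => i iT; rewrite leNgt cle.
    by rewrite sum_lagrange_coef -?cT // p1 ler10.
  apply: (orth_same_sign (esym cT) _ _ op sT) => // i.
  by rewrite inE lt_def w0 => ->.
have [w' [w'0 w'w w'ex op']] := orth_reduce w0 wbig op.
apply: (IH w') => //; last exact: leq_trans (proper_card w'w) wk.
move=> i w'i; apply: wp; have /fintype.subsetP/(_ i) := proper_sub w'w.
by rewrite !inE; apply.
Qed.

Lemma subset_of_card (A : {set I}) n : (n <= #|A|)%N ->
  exists2 B : {set I}, B \subset A & #|B| = n.
Proof.
move=> nA; exists [set i in take n (enum A)].
  by apply/fintype.subsetP => i; rewrite inE => /mem_take; rewrite mem_enum.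
rewrite cardsE (card_uniqP _) ?take_uniq ?enum_uniq //.
by rewrite size_takel // -cardE.
Qed.

Lemma orth_alternating n w p : (n < #|I|)%N -> (forall i, 0 <= w i) ->
  (n <= #|supp w|)%N -> (size p <= n.+1)%N -> p.[0] = 1 -> orth n w p ->
  exists2 T : {set I}, #|T| = n.+1 &
    forall t, t \in T -> 0 <= p.[x t] / (nodal (T :\ t)).[x t].
Proof.
move=> nI w0 nw sp p1 op.
(* Nodes where [p] vanishes do not affect orthogonality, so their weights may be set to 0. *)
pose w1 i := if p.[x i] == 0 then 0 else w i.
have op1 : orth n w1 p.
  move=> r sr; rewrite -[RHS](op r sr); apply: eq_bigr => i _.
  by rewrite /w1; case: eqP => // ->; rewrite !mulr0.
have [/existsP w1ex|/existsPn w1n] := boolP [exists i, w1 i != 0].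
  apply: (orth_alternating_nonroot _ w1ex _ sp p1 op1) => i.
    by rewrite /w1; case: ifP.
  by rewrite /w1; case: ifP => [|/negbT //]; rewrite eqxx.
(* Here [p] vanishes on the whole support. Take [n] of its nodes and a further node [t0], which
   exists as [n < #|I|]: all coefficients are 0 except that of [t0], which is then 1. *)
have [A /fintype.subsetP Aw cA] := subset_of_card nw.
have pA i : i \in A -> p.[x i] = 0.
  move=> /Aw; rewrite inE => wi; apply/eqP; move: (w1n i).
  by rewrite /w1; case: ifP => // _; rewrite wi.
have [t0 t0A] : exists t0, t0 \notin A.
  apply/existsP; apply: contraLR nI => /existsPn AI.
  rewrite -leqNgt -cA; apply/subset_leq_card/fintype.subsetP => i _.
  by rewrite -[_ \in _]negbK AI.
have cT : #|t0 |: A| = n.+1 by rewrite cardsU1 t0A cA.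
exists (t0 |: A) => // t; rewrite in_setU1 => /orP[/eqP ->|tA]; last first.
  by rewrite pA // mul0r.
have : \sum_(t in t0 |: A) p.[x t] / (nodal ((t0 |: A) :\ t)).[x t] = 1.
  by rewrite sum_lagrange_coef // cT.
rewrite (big_setU1 _ t0A) /= big1 ?addr0 => [|i iA]; first by move=> ->.
by rewrite pA // mul0r.
Qed.
End Nodes.

Local Open Scope classical_set_scope.
Local Open Scope ring_scope.

(** * Convex hulls of finite families *)

Section FiniteHull.
Set Implicit Arguments.
Unset Strict Implicit.
Variables (R : realType) (E : lmodType R) (J : finType) (f : J -> E).

Lemma conv_lmodE (t : {i01 R}) (y z : convex_lmodType E) :
  conv t y z = t%:num *: (y : E) + (1 - t%:num) *: (z : E).
Proof. by []. Qed.

(** Induction on [#|A|]: split off a point [a] and divide the other coefficients by [1 - c a]. If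
    [c a = 1] they all vanish. *)
Lemma convex_set_sum (K : set E) (A : {set J}) (c : J -> R) :
  @convex_set R E K -> (forall j, j \in A -> K (f j)) ->
  (forall j, j \in A -> 0 <= c j) -> \sum_(j in A) c j = 1 ->
  K (\sum_(j in A) c j *: f j).
Proof.
move=> cK; have [k] := ubnP #|A|; elim: k A c => // k IH A c.
rewrite ltnS => Ak KA c0 c1.
have [A0|[a aA]] := finset.set_0Vmem A.
  by move/eqP: c1; rewrite A0 big_set0 eq_sym oner_eq0.
have cD0 j : j \in A :\ a -> 0 <= c j by move=> /setD1P[_ /c0].
have cE : \sum_(j in A :\ a) c j = 1 - c a.
  by rewrite -c1 [\sum_(j in A) _](big_setD1 a) //= addrAC subrr add0r.
have ca1 : c a <= 1 by rewrite -subr_ge0 -cE sumr_ge0.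
rewrite (big_setD1 a) //=.
have [ca|ca] := eqVneq (c a) 1.
  have z j : j \in A :\ a -> c j = 0.
    by move: j; apply: psumr_eq0P => //; rewrite cE ca subrr.
  rewrite big1 => [|j jA]; last by rewrite z // scale0r.
  by rewrite addr0 ca scale1r; apply: KA.
have d0 : 1 - c a != 0 by rewrite subr_eq0 eq_sym.
have dge0 : 0 <= 1 - c a by rewrite subr_ge0.
have := cK (f a) (\sum_(j in A :\ a) (c j / (1 - c a)) *: f j)
  (Itv01 (c0 a aA) ca1).
rewrite !inE => /(_ (KA a aA)) H.
have : K (\sum_(j in A :\ a) (c j / (1 - c a)) *: f j).
  apply: IH.
  - by move: Ak; rewrite (cardsD1 a) aA.
  - by move=> j /setD1P[_ /KA].
  - by move=> j jA; rewrite divr_ge0 // cD0.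
  - by rewrite -mulr_suml cE divff.
move=> /H; rewrite conv_lmodE /=; congr (K (_ + _)).
rewrite scaler_sumr; apply: eq_bigr => j _.
by rewrite scalerA mulrC divfK.
Qed.

Lemma conv_hull_image (A : {set J}) :
  conv_hull (f @` [set j | j \in A]) =
  [set y | exists c : J -> R, [/\ forall j, j \in A -> 0 <= c j,
     \sum_(j in A) c j = 1 & y = \sum_(j in A) c j *: f j]].
Proof.
apply/seteqP; split.
  apply: smallest_sub => [y z t|_ [a /= aA <-]].
    rewrite !inE => -[c [c0 c1 ->]] [d [d0 d1 ->]].
    exists (fun j => t%:num * c j + (1 - t%:num) * d j); split.
    - move=> j jA; apply: addr_ge0; apply: mulr_ge0;
        rewrite ?c0 ?d0 ?subr_ge0 //.
    - by rewrite big_split /= -!mulr_sumr c1 d1 !mulr1 addrC subrK.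
    rewrite conv_lmodE !scaler_sumr -big_split /=; apply: eq_bigr => j _.
    by rewrite [RHS]scalerDl -!scalerA.
  exists (fun j => (j == a)%:R); split.
  - by move=> j _; rewrite ler0n.
  - by rewrite (big_setD1 a) //= eqxx big1 ?addr0 // => j /setD1P[/negPf->].
  rewrite (big_setD1 a) //= eqxx scale1r big1 ?addr0 // => j /setD1P[/negPf->].
  by rewrite scale0r.
move=> _ [c [c0 c1 ->]] K [cK fK]; apply: convex_set_sum => // j jA.
by apply: fK; exists j.
Qed.

End FiniteHull.

(** * Shrinkage vectors as values of orthogonal polynomials *)

Section Shrinkage.
Set Implicit Arguments.
Unset Strict Implicit.
Variables (R : realType) (m n : nat) (lambda : 'cV[R]_m).
Local Notation x := (fun i : 'I_m => lambda i 0).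
Hypothesis x_inj : injective x.
Hypothesis x_gt0 : forall i, 0 < x i.
Implicit Types (psi y : 'cV[R]_m) (p r : {poly R}) (T tau : {set 'I_m}).

Lemma mulmx_VmxT (v : 'rV[R]_n) i :
  (v *m (Vmx n lambda)^T) 0 i = (rVpoly v).[lambda i 0].
Proof.
rewrite mxE (horner_coef_wide _ (size_poly _ _)).
by apply: eq_bigr => k _; rewrite coef_rVpoly_ord !mxE.
Qed.

Lemma mulmx_Vmx (c : 'cV[R]_n) i :
  (Vmx n lambda *m c) i 0 = (rVpoly c^T).[lambda i 0].
Proof. by rewrite -mulmx_VmxT -trmx_mul [RHS]mxE. Qed.

Lemma mulmx_diagc psi y i : (diagc psi *m y) i 0 = psi i 0 * y i 0.
Proof. by rewrite /diagc mul_diag_mx !mxE. Qed.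

(** Gram matrix of the monomials of degree below [n] for the weights [psi i 0 * lambda i 0]; it is
    the matrix inverted in [zvec]. *)
Definition gram psi : 'M[R]_n :=
  (Vmx n lambda)^T *m diagc psi *m diagc lambda *m Vmx n lambda.

Lemma mulmx_gram psi (v : 'rV[R]_n) (c : 'cV[R]_n) :
  (v *m (gram psi *m c)) 0 0 =
  \sum_i psi i 0 * lambda i 0 * (rVpoly v).[lambda i 0] *
    (rVpoly c^T).[lambda i 0].
Proof.
rewrite /gram -!mulmxA mulmxA mxE; apply: eq_bigr => i _.
rewrite mulmx_VmxT !mulmx_diagc mulmx_Vmx.
by rewrite mulrCA [(rVpoly v).[_] * _]mulrCA !mulrA.
Qed.

(** A kernel vector, read as a polynomial, has zero weighted square norm, so it vanishes by
    [weighted_sq_eq0]. *)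
Lemma gram_unit psi : Dset R m n psi -> gram psi \in unitmx.
Proof.
case=> psi0 npsi; rewrite -row_free_unit; apply: inj_row_free => v vG.
have : \sum_i psi i 0 * x i * (rVpoly v).[x i] ^+ 2 = 0.
  transitivity ((v *m (gram psi *m v^T)) 0 0);
    last by rewrite mulmxA vG mul0mx mxE.
  by rewrite mulmx_gram trmxK; apply: eq_bigr => i _; rewrite expr2 !mulrA.
move/(weighted_sq_eq0 x_inj x_gt0 psi0 npsi (size_poly _ _)).
rewrite -/(rVpoly v) => v0.
by rewrite -[v]rVpolyK v0 linear0.
Qed.

(** Take [p = 1 - q * 'X], where [q] has coefficient vector [b]: the normal equations [bE] say
    exactly that [p] is orthogonal to all polynomials of degree below [n]. *)
Lemma zvec_orth psi : Dset R m n psi ->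
  exists p, [/\ (size p <= n.+1)%N, p.[0] = 1,
    orth x n (fun i => psi i 0) p & zvec n lambda psi = \col_i p.[x i]].
Proof.
move=> Dpsi; pose b : 'cV[R]_n := invmx (gram psi) *m ((Vmx n lambda)^T *m psi).
have bE : gram psi *m b = (Vmx n lambda)^T *m psi.
  by rewrite mulKVmx // gram_unit.
pose q := rVpoly b^T; pose p : {poly R} := 1 - q * 'X.
have pE a : p.[a] = 1 - a * q.[a] by rewrite !hornerE mulrC.
exists p; split.
- rewrite (leq_trans (size_polyD _ _)) // size_polyN size_poly1 geq_max /=.
  rewrite (leq_trans (size_polyMleq _ _)) // size_polyX addn2 /= ltnS.
  exact: size_poly.
- by rewrite pE mul0r subr0.
- move=> r sr; pose v : 'rV[R]_n := poly_rV r.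
  transitivity
    ((v *m ((Vmx n lambda)^T *m psi)) 0 0 - (v *m (gram psi *m b)) 0 0).
    rewrite mulmx_gram mulmxA mxE -sumrB; apply: eq_bigr => i _.
    rewrite mulmx_VmxT poly_rV_K // pE mulrBr mulrBl mulr1 [r.[_] * _]mulrC.
    by rewrite [in RHS]mulrAC !mulrA.
  by rewrite bE subrr.
apply/colP => i; rewrite /zvec -/(gram psi) -!mulmxA -/b.
rewrite mxE [in RHS]mxE [X in X + _]mxE [X in _ + X]mxE.
by rewrite mulmx_diagc mulmx_Vmx pE.
Qed.

Lemma zvec_eq psi p : Dset R m n psi -> (size p <= n.+1)%N -> p.[0] = 1 ->
  orth x n (fun i => psi i 0) p -> zvec n lambda psi = \col_i p.[x i].
Proof.
move=> Dpsi sp p1 op; have [q [sq q1 oq ->]] := zvec_orth Dpsi.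
have [psi0 npsi] := Dpsi.
by rewrite (orth_unique x_inj x_gt0 psi0 npsi sp sq p1 q1 op oq).
Qed.

(** The weights live on [tau], where the nodal polynomial vanishes, so orthogonality is immediate
    and uniqueness identifies [zvec]. *)
Lemma ztau_nodal tau : #|tau| = n ->
  ztau n lambda tau = \col_i (nodal x tau).[x i].
Proof.
move=> ctau; rewrite /ztau; set psi := selmx R tau *m const_mx 1.
have psiE i : psi i 0 = (i \in tau)%:R.
  rewrite mxE; have [itau|itau] := boolP (i \in tau).
    rewrite (bigD1 (enum_rank_in itau i)) //= !mxE enum_rankK_in // eqxx mulr1.
    rewrite big1 ?addr0 // => k kr; rewrite !mxE mulr1.
    case: eqP => // ik; case/eqP: kr; apply: enum_val_inj.
    by rewrite enum_rankK_in.
  rewrite big1 // => k _; rewrite !mxE; case: eqP => [ik|]; rewrite ?mul0r //.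
  by rewrite ik enum_valP in itau.
apply: zvec_eq.
- split=> [i|]; first by rewrite psiE ler0n.
  rewrite -ctau; apply/subset_leq_card/fintype.subsetP => i itau.
  by rewrite inE psiE itau oner_eq0.
- by rewrite -ctau size_nodal.
- exact: nodal_at0.
move=> r _; apply: big1 => i _; rewrite psiE; apply/eqP.
rewrite !mulf_eq0; case: (boolP (i \in tau)) => it; last by rewrite eqxx.
by rewrite nodal_eq0 // it orbT.
Qed.

(** * The hulls: coefficients, closedness, comparison with the image *)

Definition hull T : set 'cV[R]_m := conv_hull (ztau n lambda @` ksubsets T n).

Lemma ksubsetsD1 T : #|T| = n.+1 ->
  ksubsets T n = (fun t => T :\ t) @` [set t | t \in T].
Proof.
move=> cT; apply/seteqP; split => [tau [tauT ctau]|_ [t /= tT <-]].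
  have [t tT ttau] : exists2 t, t \in T & t \notin tau.
    apply/fintype.subsetPn; apply: contra_eqN cT => Ttau.
    by rewrite neq_ltn ltnS -ctau subset_leq_card.
  exists t => //; apply/esym/eqP; rewrite eqEcard subsetD1 tauT ttau.
  by move: cT; rewrite (cardsD1 t) tT add1n => -[->]; rewrite ctau /= leqnn.
by split; [exact: subsetDl|move: cT; rewrite (cardsD1 t) tT => -[]].
Qed.

Lemma hullE T : #|T| = n.+1 ->
  hull T = [set y | exists c : 'I_m -> R, [/\ forall t, t \in T -> 0 <= c t,
    \sum_(t in T) c t = 1 &
    y = \col_i (\sum_(t in T) c t *: nodal x (T :\ t)).[x i]]].
Proof.
move=> cT; rewrite /hull (ksubsetsD1 cT) image_comp conv_hull_image.
have zE t : t \in T -> ztau n lambda (T :\ t) = \col_i (nodal x (T :\ t)).[x i].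
  by move=> tT; apply: ztau_nodal; move: cT; rewrite (cardsD1 t) tT => -[].
by apply/seteqP; split => y /= [c [c0 c1 ->]]; exists c; split => //;
   apply/colP => i; rewrite summxE mxE horner_sum;
   apply: eq_bigr => t tT; rewrite mxE zE // mxE hornerZ.
Qed.

Lemma continuous_col_functional T (c : 'I_m -> R) :
  continuous (fun y : 'cV[R]_m => \sum_(t in T) y t 0 * c t).
Proof.
apply: continuous_big => [|t _]; first exact: add_continuous.
by move=> y; apply: continuousM;
  [exact: coord_continuous|exact: cst_continuous].
Qed.

(** A point [y] of the hull determines its coefficients from its coordinates in [T], as
    [y t 0 * a t]. Hence the hull is cut out by closed conditions: coefficients nonnegative ([P]),
    with sum 1 ([S]), and reproducing every coordinate by interpolation ([D]). *)
Lemma hull_closed T : #|T| = n.+1 -> closed (hull T).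
Proof.
move=> cT; rewrite hullE //.
pose a t := ((nodal x (T :\ t)).[x t])^-1.
pose D i : set 'cV[R]_m :=
  (fun y => \sum_(t in T) y t 0 * (a t * (nodal x (T :\ t)).[x i]) - y i 0)
    @^-1` [set r | r = 0].
pose P t : set 'cV[R]_m := (fun y => y t 0 * a t) @^-1` [set r | 0 <= r].
pose S : set 'cV[R]_m :=
  (fun y => \sum_(t in T) y t 0 * a t) @^-1` [set r | r = 1].
rewrite [X in closed X](_ : _ = \bigcap_(t in [set t | t \in T]) P t `&` S
  `&` \bigcap_(i in setT) D i); last first.
  apply/seteqP; split => y.
    case=> c [c0 c1 yE].
    have yc t : t \in T -> y t 0 * a t = c t.
      by move=> tT; rewrite yE mxE horner_nodal_sum // mulfK ?nodalD1_neq0.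
    split; [split|].
    - by move=> t /= tT; rewrite /P /= yc // c0.
    - by rewrite /S /= -c1; apply: eq_bigr => t; exact: yc.
    move=> i _; rewrite /D /= yE mxE horner_sum -sumrB big1 // => t tT.
    by rewrite hornerZ -yE mulrA yc // subrr.
  case=> -[yP yS] yD; exists (fun t => y t 0 * a t); split => //.
  apply/colP => i; rewrite mxE horner_sum; have /eqP := yD i I.
  rewrite subr_eq0 => /eqP <-; apply: eq_bigr => t tT.
  by rewrite hornerZ mulrA.
have ycont t c : continuous (fun y : 'cV[R]_m => y t 0 * c).
  by move=> y; apply: continuousM;
  [exact: coord_continuous|exact: cst_continuous].
apply: closedI; [apply: closedI|].
- apply: closed_bigI => t _; have /continuous_closedP := ycont t (a t).
  by apply; exact: closed_ge.
- have /continuous_closedP := @continuous_col_functional T a.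
  by apply; exact: closed_eq.
apply: closed_bigI => i _.
have /continuous_closedP : continuous (fun y : 'cV[R]_m =>
    \sum_(t in T) y t 0 * (a t * (nodal x (T :\ t)).[x i]) - y i 0).
  move=> y; apply: continuousB; last exact: coord_continuous.
  exact: (@continuous_col_functional T
    (fun t => a t * (nodal x (T :\ t)).[x i])).
by apply; exact: closed_eq.
Qed.

Lemma zvec_hull psi : (n < m)%N -> Dset R m n psi ->
  exists2 T : {set 'I_m}, #|T| = n.+1 & hull T (zvec n lambda psi).
Proof.
move=> n_lt_m Dpsi; have [psi0 npsi] := Dpsi.
have [p [sp p1 op ->]] := zvec_orth Dpsi.
have nI : (n < #|'I_m|)%N by rewrite card_ord.
have [T cT pT] := orth_alternating x_inj x_gt0 nI psi0 npsi sp p1 op.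
exists T => //; rewrite hullE //.
exists (fun t => p.[x t] / (nodal x (T :\ t)).[x t]); split => //.
  by rewrite sum_lagrange_coef // cT.
by rewrite -lagrange_nodal ?cT.
Qed.

(** The weights come from [orth_combination]; they are positive on all [n.+1] nodes of [T]. *)
Lemma relative_interior_hull T (c : 'I_m -> R) : #|T| = n.+1 ->
  (forall t, t \in T -> 0 < c t) -> \sum_(t in T) c t = 1 ->
  (zvec n lambda @` Dset R m n)
    (\col_i (\sum_(t in T) c t *: nodal x (T :\ t)).[x i]).
Proof.
move=> cT c0 c1; pose psi : 'cV[R]_m := \col_t
  if t \in T then x t / (c t * (nodal x (T :\ t)).[x t] ^+ 2) else 0.
have w0 t : t \in T -> 0 < x t / (c t * (nodal x (T :\ t)).[x t] ^+ 2).
  move=> tT; rewrite divr_gt0 // mulr_gt0 ?c0 // lt_def sqr_ge0 andbT.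
  by rewrite expf_neq0 // nodalD1_neq0.
have Dpsi : Dset R m n psi.
  split=> [i|]; first by rewrite mxE; case: ifP => // /w0/ltW.
  apply: (@leq_trans #|T|); first by rewrite cT.
  apply/subset_leq_card/fintype.subsetP => t tT.
  by rewrite inE mxE tT gt_eqF // w0.
exists psi => //; apply: zvec_eq => //.
- apply: (leq_trans (size_sum _ _ _)); apply/bigmax_leqP => t tT.
  rewrite (leq_trans (size_scale_leq _ _)) // (leq_trans (size_nodal _ _)) //.
  by rewrite -cT [#|T|](cardsD1 t) tT.
- rewrite horner_sum -[RHS]c1; apply: eq_bigr => t _.
  by rewrite hornerZ nodal_at0 mulr1.
move=> r sr; rewrite -[RHS](orth_combination x_inj x_gt0 cT c0 sr).
by apply: eq_bigr => i _; rewrite mxE.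
Qed.

Lemma hull_sub_closure T : #|T| = n.+1 ->
  hull T `<=` closure (zvec n lambda @` Dset R m n).
Proof.
move=> cT y; rewrite hullE // => -[c [c0 c1 yE]] B yB.
(* [z] is the barycentre of the vertices; strictly between [y] and [z] all coefficients are
   positive, so those points lie in the image. *)
pose z : 'cV[R]_m :=
  \col_i (\sum_(t in T) n.+1%:R^-1 *: nodal x (T :\ t)).[x i].
pose h (e : R) : 'cV[R]_m := y + e *: (z - y).
have h0 : h e @[e --> 0^'+] --> y.
  apply: cvg_at_right_filter; rewrite -[X in _ --> X](_ : h 0 = _); last first.
    by rewrite /h scale0r addr0.
  by apply: cvgD; [exact: cvg_cst|exact: scalel_continuous].
have : \forall e \near (0 : R)^'+, [/\ 0 < e, e < 1 & B (h e)].
  near=> e; split; near: e; [exact: nbhs_right_gt|exact: nbhs_right_lt|].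
  exact: h0.
case/filter_ex => e [e0 e1 Bh]; exists (h e); split => //.
pose d t := (1 - e) * c t + e * n.+1%:R^-1.
have -> : h e = \col_i (\sum_(t in T) d t *: nodal x (T :\ t)).[x i].
  apply/colP => i; rewrite /h /z yE !mxE !horner_sum.
  rewrite (_ : forall a b : R, a + e * (b - a) = (1 - e) * a + e * b).
    rewrite !mulr_sumr -big_split /=.
    by apply: eq_bigr => t _; rewrite !hornerZ [RHS]mulrDl !mulrA.
  by move=> a b; rewrite mulrBr mulrBl mul1r addrA addrAC.
apply: relative_interior_hull => // [t tT|].
  rewrite ltr_wpDl // ?mulr_gt0 ?invr_gt0 ?ltr0n //.
  by rewrite mulr_ge0 ?c0 // subr_ge0 ltW.
rewrite big_split /= -mulr_sumr c1 mulr1 sumr_const cT -[_ *+ _]mulr_natr.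
by rewrite divfK ?pnatr_eq0 // subrK.
Unshelve. all: by end_near. Qed.

End Shrinkage.

Theorem corollary3p7 (R : realType) (m n : nat) (lambda : 'cV[R]_m)
    (n_ge1 : (1 <= n)%N) (n_lt_m : (n < m)%N)
    (lambda_decr : forall i j : 'I_m, (i < j)%N -> lambda j 0 < lambda i 0)
    (lambda_pos : forall i : 'I_m, 0 < lambda i 0) :
  closure (zvec n lambda @` Dset R m n) =
  \bigcup_(T in ksubsets [set: 'I_m]%SET n.+1)
    conv_hull (ztau n lambda @` ksubsets T n).
Proof.
have x_inj : injective (fun i : 'I_m => lambda i 0).
  move=> i j ij; apply/val_inj; case: (ltngtP i j) => // /lambda_decr.
    by rewrite ij ltxx.
  by rewrite ij ltxx.
apply/seteqP; split; last first.
  by move=> y [T [_ cT]]; apply: hull_sub_closure.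
(* A finite union of closed hulls equals its own closure, so it suffices that it contains the
   image. *)
have -> : \bigcup_(T in ksubsets [set: 'I_m]%SET n.+1)
    conv_hull (ztau n lambda @` ksubsets T n) =
    closure (\bigcup_(T in ksubsets [set: 'I_m]%SET n.+1) hull n lambda T).
  apply/closure_id/closed_bigcup => [|T [_ cT]].
    exact: cardinality.finite_finset.
  exact: hull_closed.
apply: closureS => _ [psi Dpsi <-].
have [T cT zT] := zvec_hull x_inj lambda_pos n_lt_m Dpsi.
by exists T => //; split => //; exact: finset.subsetT.
Qed.
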